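(* Suppose that $(Y(t))_{t\in\mathbb{R}^d}$ is a causal CARMA$(p,q)$ (resp. causal GCARMA) random field such that $\Lambda$ has a finite second moment and $A_i$ has distinct eigenvalues for $i=1,\dots,d$. Then the spectral density $f$ of $Y$ has the form $$f(\omega)=\frac{\kappa_2}{(2\pi)^d}\sum_{\lambda_1}\cdots\sum_{\lambda_d}\sum_{v\in\{-1,1\}^d}\frac{d_v(\lambda_1,\dots,\lambda_d)}{(\boldsymbol{i}v_1\omega_1-\lambda_1)\cdots(\boldsymbol{i}v_d\omega_d-\lambda_d)},\quad\omega\in\mathbb{R}^d,$$ where $\boldsymbol{i}$ is the imaginary unit, $\sum_{\lambda_i}$ is the sum over the distinct eigenvalues of $A_i$, and $d_v(\lambda_1,\dots,\lambda_d)$ are the complex coefficients in the representation of the autocovariance function $\gamma$ of $Y$ recalled in the context.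
   Context: Lévy bases. On a fixed complete probability space, a homogeneous Lévy basis $\Lambda$ on $\mathbb{R}^d$ with characteristics $(\beta,\sigma^2,\nu)$ ($\beta\in\mathbb{R}$, $\sigma\ge0$, $\nu$ a Lévy measure on $\mathbb{R}$) is the family indexed by bounded Borel sets $A\subset\mathbb{R}^d$, $$\Lambda(A)=\beta\,\mathrm{Leb}(A)+\sigma W(A)+\int_{\mathbb{R}^d}\int_{\mathbb{R}}1_A(s)z1_{\{|z|\le1\}}(\mathfrak p-\mathfrak q)(ds,dz)+\int_{\mathbb{R}^d}\int_{\mathbb{R}}1_A(s)z1_{\{|z|>1\}}\mathfrak p(ds,dz),$$ where $W$ is Gaussian white noise on $\mathbb{R}^d$ with $\mathrm{Var}(W(A))=\mathrm{Leb}(A)$ and $\mathfrak p$ is a Poisson random measure on $\mathbb{R}^d\times\mathbb{R}$ with intensity $\mathfrak q=\mathrm{Leb}\otimes\nu$, independent of $W$. $\Lambda$ has a finite second moment if $\int_{\mathbb{R}}z^2\nu(dz)<\infty$, with variance $\kappa_2:=\sigma^2+\int_{\mathbb{R}}z^2\nu(dz)$. Integrals of deterministic functions with respect to $\Lambda$ are Rajput–Rosiński integrals, taken componentwise for vector-valued integrands. Companion matrix. The companion matrix of a monic polynomial $a(z)=z^p+\alpha_1z^{p-1}+\dots+\alpha_p$ is the $p\times p$ matrix with ones on the superdiagonal, last row $(-\alpha_p,-\alpha_{p-1},\dots,-\alpha_1)$ and zeros elsewhere (for $p=1$: $(-\alpha_1)$). GCARMA. Let $p\ge1$, $b,c\in\mathbb{R}^p$,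 $A_1,\dots,A_d\in\mathbb{R}^{p\times p}$ with all eigenvalues having strictly negative real parts, and $\Lambda$ a homogeneous Lévy basis on $\mathbb{R}^d$ with $\int_{\mathbb{R}}\log(|z|)^d1_{\{|z|>1\}}\nu(dz)<\infty$. $(Y(t))_{t\in\mathbb{R}^d}$ is a causal GCARMA random field if $$Y(t)=b^\top X(t),\quad X(t)=\int_{-\infty}^{t_1}\cdots\int_{-\infty}^{t_d}e^{A_1(t_1-s_1)}\cdots e^{A_d(t_d-s_d)}c\,\Lambda(ds),\quad t\in\mathbb{R}^d.$$ CARMA. For integers $0\le q<p$, $Y$ is a causal CARMA$(p,q)$ random field if it is given by the same equations where $b=(b_0,\dots,b_{p-1})^\top$ with $b_q\ne0$ and $b_i=0$ for $i>q$, $c=(0,\dots,0,1)^\top$, $A_i$ is the companion matrix of a real monic polynomial $a_i$ of degree $p$ whose roots have strictly negative real parts, and $\Lambda$ satisfies the same log-moment condition. Autocovariance and spectral density. $\gamma(t)=\mathrm{Cov}[Y(r+t),Y(r)]$ (independent of $r\in\mathbb{R}^d$). When $\Lambda$ has a finite second moment and all $A_i$ have distinct eigenvalues, there are complex coefficients $d_v(\lambda_1,\dots,\lambda_d)=d_{-v}(\lambda_1,\dots,\lambda_d)$, $v\in\{-1,1\}^d$, such that for every $v\in\{-1,1\}^d$ and every $t\in\mathbb{R}^d$ with $v_it_i\ge0$ for all $i$, $$\gamma(t)=\kappa_2\sum_{\lambda_1}\cdots\sum_{\lambda_d}d_v(\lambda_1,\dots,\lambda_d)e^{\lambda_1|t_1|+\cdots+\lambda_d|t_d|}.$$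 In particular $\gamma$ is integrable, and the spectral density is $f(\omega)=\frac{1}{(2\pi)^d}\int_{\mathbb{R}^d}\gamma(t)e^{-\boldsymbol{i}\omega\cdot t}dt$, $\omega\in\mathbb{R}^d$. *)

(* Defs.v *)
From HB Require Import structures.
From mathcomp Require Import all_boot all_order all_algebra.
From mathcomp Require Import complex.
From mathcomp Require Import all_classical all_reals all_analysis.
From mathcomp Require Import measurable_realfun.

Set Implicit Arguments.
Unset Strict Implicit.
Unset Printing Implicit Defensive.

Import Order.TTheory GRing.Theory Num.Theory.
Import numFieldNormedType.Exports.
Import HBSimple.

Local Open Scope classical_set_scope.
Local Open Scope ring_scope.

(** [R^d] is the type of [d]-tuples over [measurableTypeR R], i.e. over [R] with
    the Borel sigma-algebra on which [lebesgue_measure] is defined; tuples carry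
    the product sigma-algebra. *)
Notation Rd R d := (d.-tuple (measurableTypeR R)).

Section euclidean.
Variables (R : realType) (d : nat).
Implicit Types s t : Rd R d.

Definition rcoord t (i : 'I_d) : R := tnth t i.

Definition addv s t : Rd R d := [tuple rcoord s i + rcoord t i | i < d].

Definition dotv s t : R := \sum_(i < d) rcoord s i * rcoord t i.

Definition bounded_borel (A : set (Rd R d)) :=
  measurable A /\ exists M : R, forall s, A s -> forall i, `|rcoord s i| <= M.

End euclidean.

Section lebesgue_measure_tuple.
Variable R : realType.

Definition tcons n (x : measurableTypeR R * Rd R n) : Rd R n.+1 :=
  [the n.+1.-tuple _ of x.1 :: x.2].

Definition tuncons n (t : Rd R n.+1) : measurableTypeR R * Rd R n :=
  (tnth t ord0, [tuple of behead t]).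

Lemma measurable_tcons n : measurable_fun [set: measurableTypeR R * Rd R n] (@tcons n).
Proof. exact: measurable_cons. Qed.

Lemma measurable_tuncons n : measurable_fun [set: Rd R n.+1] (@tuncons n).
Proof.
by apply: measurable_fun_pair; [exact: measurable_tnth|exact: measurable_behead].
Qed.

Lemma tconsK n : cancel (@tcons n) (@tuncons n).
Proof. by move=> [x v]; congr pair; exact/val_inj. Qed.

Section step.
Variables (n : nat) (m : {sigma_finite_measure set (Rd R n) -> \bar R}).

Definition leb_step : set (Rd R n.+1) -> \bar R :=
  pushforward (lebesgue_measure \x m)%E (@tcons n).

Let leb_step0 : leb_step set0 = 0%E.
Proof. by rewrite /leb_step /pushforward preimage_set0 measure0. Qed.

Let leb_step_ge0 A : (0 <= leb_step A)%E.
Proof. rewrite /leb_step /pushforward; exact: measure_ge0. Qed.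

Let leb_step_sigma_additive : semi_sigma_additive leb_step.
Proof.
exact: (@measure_semi_sigma_additive _ _ _
  (measure_function_pushforward__canonical__measure_function_Measure
    (lebesgue_measure \x m)%E (@measurable_tcons n))).
Qed.

HB.instance Definition _ := isMeasure.Build _ _ _ leb_step
  leb_step0 leb_step_ge0 leb_step_sigma_additive.

Let leb_step_sigma_finite : sigma_finite setT leb_step.
Proof.
have /sigma_finiteP[F [TF ndF Foo]] := sigma_finiteT (@lebesgue_measure R).
have /sigma_finiteP[G [TG ndG Goo]] := sigma_finiteT m.
have FGT : \bigcup_k (F k `*` G k) = setT.
  rewrite -setXTT TF TG predeqE => -[x y]; split.
    by move=> [k _ []/= ? ?]; split; exists k.
  move=> [/= [i _ Fix] [k _ Gky]]; exists (maxn i k) => //; split.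
  - by move: x Fix; exact/subsetPset/ndF/leq_maxl.
  - by move: y Gky; exact/subsetPset/ndG/leq_maxr.
exists (fun k => @tuncons n @^-1` (F k `*` G k)).
  by rewrite -preimage_bigcup FGT preimage_setT.
move=> k; have [? ?] := Foo k; have [? ?] := Goo k; split.
  rewrite -[X in measurable X]setTI; apply: measurable_tuncons => //.
  exact: measurableX.
rewrite /leb_step /pushforward (_ : _ @^-1` _ = F k `*` G k).
  by rewrite product_measure1E// lte_mul_pinfty// ge0_fin_numE.
by rewrite -comp_preimage (_ : _ \o _ = id)//; apply/funext => x; exact: tconsK.
Qed.

HB.instance Definition _ :=
  Measure_isSigmaFinite.Build _ _ _ leb_step leb_step_sigma_finite.

End step.

Fixpoint lebd (d : nat) : {sigma_finite_measure set (Rd R d) -> \bar R} :=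
  match d with
  | 0 => [the {sigma_finite_measure set (Rd R 0) -> \bar R}
            of dirac [tuple]]
  | n.+1 => [the {sigma_finite_measure set (Rd R n.+1) -> \bar R}
            of leb_step (lebd n)]
  end.

Lemma lebd_box d (B : 'I_d -> set (measurableTypeR R)) : (forall i, measurable (B i)) ->
  lebd d [set s | forall i, B i (tnth s i)] =
  (\prod_(i < d) lebesgue_measure (B i))%E.
Proof.
elim: d B => [|d IHd] B mB /=.
  by rewrite big_ord0 diracE mem_set//= => -[].
rewrite big_ord_recl -IHd// /leb_step /pushforward -product_measure1E//.
  congr (_ _); apply/seteqP; split=> [[x v]/= H|[x v]/= [Hx Hv] i].
    split; first exact: (H ord0).
    by move=> i; have := H (lift ord0 i); rewrite tnthS.
  by have [j ->|->] := unliftP ord0 i; [rewrite tnthS; exact: Hv|].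
rewrite (_ : mkset _ =
    \bigcap_(i in [set: 'I_d]) (fun s => tnth s i) @^-1` B (lift ord0 i)).
  apply: fin_bigcap_measurable => // i _.
  by rewrite -[X in measurable X]setTI; exact: measurable_tnth.
by apply/seteqP; split=> [s H i _|s H i]; [exact: H|exact: (H i)].
Qed.

End lebesgue_measure_tuple.
Arguments lebd {R} d.

Section complex_tools.
Variable R : realType.
Local Notation C := R[i].
Local Open Scope complex_scope.

Definition cexp (z : C) : C :=
  (expR (complex.Re z))%:C * (cos (complex.Im z) +i* sin (complex.Im z)).

Definition Cintegral disp (T : measurableType disp)
    (mu : {measure set T -> \bar R}) (f : T -> C) : C :=
  (\int[mu]_x complex.Re (f x)) +i* (\int[mu]_x complex.Im (f x)).

Definition ceigenvalue n (A : 'M[R]_n) (l : C) : bool :=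
  eigenvalue (map_mx (real_complex R) A) l.

Definition stable n (A : 'M[R]_n) :=
  forall l, ceigenvalue A l -> complex.Re l < 0.

(** An [n x n] matrix has distinct eigenvalues when it has [n] of them. *)
Definition distinct_eigenvalues n (A : 'M[R]_n) :=
  exists2 l : 'I_n -> C, injective l & forall i, ceigenvalue A (l i).

Definition expm n (A : 'M[R]_n) : 'M[R]_n :=
  \matrix_(i, j) limn (series (fun k : nat => (k`!%:R^-1 *: A ^+ k) i j)).

(** [companionmx a] has size [(size a).-1]; [conform_mx] casts it to size [p],
    and is only used below when [size a = p.+1]. *)
Definition companion p (a : {poly R}) : 'M[R]_p :=
  conform_mx (0 : 'M[R]_p) (companionmx a).

End complex_tools.

Section probability_tools.
Context {R : realType} {disp} {T : measurableType disp} (P : probability T R).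
Local Open Scope ereal_scope.

Definition cvg_prob (X : nat -> T -> R) (Y : T -> R) :=
  forall e : R, (0 < e)%R ->
    (fun n => P [set w | (e <= `|X n w - Y w|)%R]) @ \oo --> 0.

(** [normal_prob] with standard deviation [0] is not the Dirac mass. *)
Definition gaussian_law (m v : R) (B : set R) : \bar R :=
  if v == 0%R then \d_m B else normal_prob m (Num.sqrt v) B.

Definition generated_sigma (I : Type) d' (U : measurableType d')
    (D : set I) (X : I -> T -> U) : set (set T) :=
  <<s [set E | exists2 i, D i & exists2 B, measurable B & E = X i @^-1` B] >>.

Definition independent_sigma (F G : set (set T)) :=
  forall E E', F E -> G E' -> P (E `&` E') = P E * P E'.

Definition mutually_independent n d' (U : measurableType d')
    (X : 'I_n -> T -> U) :=
  forall B : 'I_n -> set U, (forall i, measurable (B i)) ->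
    P (\bigcap_(i in [set: 'I_n]) (X i @^-1` B i)) =
    \prod_(i < n) P (X i @^-1` B i).

(** [poisson_pmf] at rate [0] is not the Dirac mass at [0], whence the explicit
    formula. *)
Definition poisson_random_measure d' (U : measurableType d')
    (q : set U -> \bar R) (p : R.-ker T ~> U) :=
  (forall B, measurable B -> q B < +oo -> forall k : nat,
    P [set w | p w B = k%:R%:E] =
    (fine (q B) ^+ k / k`!%:R * expR (- fine (q B)))%:E) /\
  (forall B, measurable B -> q B = +oo -> P [set w | p w B = +oo] = 1) /\
  (forall n (B : 'I_n -> set U), (forall i, measurable (B i)) ->
    trivIset [set: 'I_n] B ->
    mutually_independent (fun i w => p w (B i))).

End probability_tools.

Section levy_basis.
Context {R : realType} {disp} {T : measurableType disp} (P : probability T R).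
Variable d : nat.
Local Notation Rd := (Rd R d).
Local Notation MR := (measurableTypeR R).

Definition white_noise (W : set Rd -> {RV P >-> R}) :=
  forall n (A : 'I_n -> set Rd) (a : 'I_n -> R),
    (forall i, bounded_borel (A i)) ->
    forall B, measurable B ->
    P [set w | B (\sum_(i < n) a i * W (A i) w)] =
    gaussian_law 0
      (\sum_(i < n) \sum_(j < n)
        a i * a j * fine (lebd d (A i `&` A j))) B.

Definition levy_measure (nu : {measure set MR -> \bar R}) :=
  nu [set 0] = 0%E /\ (\int[nu]_(z in setT) (Num.min 1 ((z : R) ^+ 2))%:E < +oo)%E.

Section jumps.
Variables (nu : {sigma_finite_measure set MR -> \bar R}).
Variable p : R.-ker T ~> (Rd * MR)%type.
Variable A : set Rd.

Definition big_jumps (w : T) : R :=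
  \int[p w]_(x in A `*` [set z : MR | 1 < `|z : R|]) (x.2 : R).

Definition compensated_jumps (e : R) (w : T) : R :=
  let D := A `*` [set z : MR | e < `|z : R| <= 1] in
  \int[p w]_(x in D) (x.2 : R) - \int[(lebd d \x nu)%E]_(x in D) (x.2 : R).

(** The integral of [1_A(s) z 1_{|z| <= 1}] against the compensated Poisson
    random measure is the limit of its truncations to [e < |z|]. *)
Definition small_jumps (J : T -> R) :=
  cvg_prob P (fun n => compensated_jumps n.+1%:R^-1) J.

End jumps.

Definition levy_basis (beta sigma : R)
    (nu : {sigma_finite_measure set MR -> \bar R})
    (Lam : set Rd -> {RV P >-> R}) :=
  0 <= sigma /\ levy_measure nu /\
  exists (W : set Rd -> {RV P >-> R}) (p : R.-ker T ~> (Rd * MR)%type)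
    (J : set Rd -> {RV P >-> R}),
    [/\ white_noise W,
        poisson_random_measure P (lebd d \x nu)%E p,
        independent_sigma P
          (generated_sigma (@bounded_borel R d) (fun A => W A : T -> R))
          (generated_sigma measurable (fun B w => p w B)),
        forall A, bounded_borel A -> small_jumps nu p A (J A) &
        forall A, bounded_borel A ->
          {ae P, forall w, Lam A w =
            beta * fine (lebd d A) + sigma * W A w + J A w + big_jumps p A w}].

Definition bounded_support (f : Rd -> R) :=
  exists M : R, forall s, f s != 0 -> forall i, `|rcoord s i| <= M.

Definition simple_levy_integral (Lam : set Rd -> {RV P >-> R})
    (A : set Rd) (f : {sfun Rd >-> R}) (w : T) : R :=
  \sum_(x \in range f `\ 0) x * Lam (A `&` f @^-1` [set x]) w.

(** [levy_integral Lam f X]: [f] is integrable with respect to [Lam], and [X] is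
    a version of its integral over [R^d]. The control measure of a homogeneous
    Levy basis is a multiple of the Lebesgue measure. *)
Definition levy_integral (Lam : set Rd -> {RV P >-> R}) (f : Rd -> R)
    (X : {RV P >-> R}) :=
  measurable_fun setT f /\
  exists g : nat -> {sfun Rd >-> R},
    [/\ forall n, bounded_support (g n),
        {ae (lebd d : set Rd -> \bar R), forall s, (g n s : R) @[n --> \oo] --> f s},
        forall A, measurable A -> exists XA : {RV P >-> R},
          cvg_prob P (fun n => simple_levy_integral Lam A (g n)) XA &
        cvg_prob P (fun n => simple_levy_integral Lam setT (g n)) X].

Definition log_moment (nu : {measure set MR -> \bar R}) :=
  (\int[nu]_(z in [set z : MR | (1 < `|z : R|)%R])
    (ln `|z : R| ^+ d)%:E < +oo)%E.

Definition finite_second_moment (nu : {measure set MR -> \bar R}) :=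
  (\int[nu]_z ((z : R) ^+ 2)%:E < +oo)%E.

Definition kappa2 (sigma : R) (nu : {measure set MR -> \bar R}) : R :=
  sigma ^+ 2 + \int[nu]_z ((z : R) ^+ 2).

Variable p : nat.
Implicit Types (b c : 'cV[R]_p) (A : 'I_d -> 'M[R]_p).

(** The product is non-commutative, taken in increasing order of the index. *)
Definition gcarma_kernel A c (t s : Rd) : 'cV[R]_p :=
  if [forall i, rcoord s i <= rcoord t i] then
    (\prod_(i < d) expm ((rcoord t i - rcoord s i) *: A i)) *m c
  else 0.

Definition gcarma_equations b c A (Lam : set Rd -> {RV P >-> R})
    (Y : Rd -> {RV P >-> R}) :=
  exists X : Rd -> 'I_p -> {RV P >-> R},
    (forall t k, levy_integral Lam (fun s => gcarma_kernel A c t s k 0) (X t k))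
    /\ forall t, {ae P, forall w, Y t w = (b^T *m \col_k X t k w) 0 0}.

Definition causal_gcarma b c A (beta sigma : R)
    (nu : {sigma_finite_measure set MR -> \bar R})
    (Lam : set Rd -> {RV P >-> R}) (Y : Rd -> {RV P >-> R}) :=
  [/\ (0 < p)%N, forall i, stable (A i), levy_basis beta sigma nu Lam,
      log_moment nu & gcarma_equations b c A Lam Y].

(** The type of [q] encodes [0 <= q < p]. *)
Definition causal_carma (q : 'I_p) b c A (beta sigma : R)
    (nu : {sigma_finite_measure set MR -> \bar R})
    (Lam : set Rd -> {RV P >-> R}) (Y : Rd -> {RV P >-> R}) :=
  (b q 0 != 0 /\ forall i : 'I_p, (q < i)%N -> b i 0 = 0) /\
  c = \col_i (i == p.-1 :> nat)%:R /\
  (exists a : 'I_d -> {poly R}, forall i,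
    [/\ a i \is monic, size (a i) = p.+1,
        forall l : R[i], root (map_poly (real_complex R) (a i)) l ->
          complex.Re l < 0 &
        A i = companion p (a i)]) /\
  [/\ levy_basis beta sigma nu Lam, log_moment nu
    & gcarma_equations b c A Lam Y].

Local Open Scope complex_scope.

Definition autocov (Y : Rd -> {RV P >-> R}) (r t : Rd) : R :=
  fine (covariance P (Y (addv r t)) (Y r)).

Definition eigentuples A : set {ffun 'I_d -> R[i]} :=
  [set l | forall i, ceigenvalue (A i) (l i)].

(** [{-1,1}^d] is encoded by [{ffun 'I_d -> bool}], [true] standing for [1]. *)
Definition sgn (v : {ffun 'I_d -> bool}) (i : 'I_d) : R :=
  if v i then 1 else -1.

Definition oppsgn (v : {ffun 'I_d -> bool}) : {ffun 'I_d -> bool} :=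
  [ffun i => ~~ v i].

(** [coef v l] is the coefficient [d_v(l_1, ..., l_d)]. *)
Definition autocov_representation A (k2 : R) (gamma : Rd -> R)
    (coef : {ffun 'I_d -> bool} -> {ffun 'I_d -> R[i]} -> R[i]) :=
  (forall v l, eigentuples A l -> coef v l = coef (oppsgn v) l) /\
  forall v t, (forall i, 0 <= sgn v i * rcoord t i) ->
    (gamma t)%:C =
    k2%:C * \sum_(l \in eigentuples A)
      (coef v l * cexp (\sum_(i < d) l i * `|rcoord t i|%:C)).

Definition spectral_density (gamma : Rd -> R) (omega : Rd) : R[i] :=
  ((2 * pi) ^- d)%:C *
  Cintegral (lebd d)
    (fun t => (gamma t)%:C * cexp (- ('i * (dotv omega t)%:C))).

End levy_basis.

(* Main.v *)
(** Each point of [R^d] lies in exactly one of the [2^d] product sets of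
    half-lines [[0, +oo[] (sign [true]) and []-oo, 0[] (sign [false]), and on the
    set with signs [v] the representation of the autocovariance turns
    [gamma t * exp (- i omega.t)] into a finite sum of tensor products of
    one-dimensional functions [exp (z_i |t_i|)] with
    [z_i = l_i - i v_i omega_i], [Re z_i < 0]. By Fubini each tensor product
    integrates to [\prod_i (- 1 / z_i)]. In dimension one, a multiple of
    [exp (- a u)] is added to the damped trigonometric integrand to make it
    nonnegative, so that the fundamental theorem of calculus applies on
    [[0, +oo[] without a separate integrability argument. *)

Require Import Defs.
From mathcomp Require Import all_boot all_order all_algebra.
From mathcomp Require Import complex.
From mathcomp Require Import all_classical all_reals all_analysis.
From mathcomp Require Import measurable_realfun.
From mathcomp Require Import ring.

Import Order.TTheory GRing.Theory Num.Theory.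
Import numFieldNormedType.Exports.

Local Open Scope classical_set_scope.
Local Open Scope ring_scope.
Local Open Scope complex_scope.

Set Implicit Arguments.
Unset Strict Implicit.

(** * Damped trigonometric integrals on the half-line *)

Section halfline.
Variable R : realType.
Local Notation mu := (@lebesgue_measure R).

Lemma cvgy_expRN (a : R) : 0 < a -> expR (- (a * u)) @[u --> +oo] --> (0 : R).
Proof.
move=> a0.
apply: (@cvg_comp _ _ _ (fun u => a * u) (fun u : R => expR (- u)) _ (pinfty_nbhs R)).
  exact: gt0_cvgMry.
exact: cvgr_expR.
Qed.

(** An exponential times a combination of [1], [cos] and [sin] is differentiated within the same
    family, so every such function has an explicit primitive. *)
Lemma is_derive_damped (a b k p q x : R) :
  is_derive x 1 (fun u => expR (- (a * u)) * (k + p * cos (b * u) + q * sin (b * u)))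
    (expR (- (a * x)) * (- a * k + (- a * p + b * q) * cos (b * x)
      + (- a * q - b * p) * sin (b * x))).
Proof.
apply: is_derive_eq => /=.
rewrite /GRing.scale /=.
ring.
Qed.

(** The primitive equals [k + p] at [0] and vanishes at infinity. The constant [k] is kept free so
    that the integrand can be shifted to be nonnegative. *)
Lemma integral_damped (a b k p q : R) : 0 < a ->
  (forall u, 0 <= - a * k + (- a * p + b * q) * cos (b * u)
      + (- a * q - b * p) * sin (b * u)) ->
  (\int[mu]_(u in `[0%R, +oo[) (expR (- (a * u)) *
     (- a * k + (- a * p + b * q) * cos (b * u)
      + (- a * q - b * p) * sin (b * u)))%:E = (- (k + p))%:E)%E.
Proof.
move=> a0 f0.
pose F (u : R) := expR (- (a * u)) * (k + p * cos (b * u) + q * sin (b * u)).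
have dF x := is_derive_damped a b k p q x.
have cF : continuous F.
  by move=> x; apply: differentiable_continuous; apply/derivable1_diffP/ex_derive.
rewrite (@ge0_continuous_FTC2y _ _ F _ 0).
- by rewrite /F !mulr0 oppr0 expR0 cos0 sin0 mul1r mulr1 mulr0 addr0 -EFinB sub0r.
- by move=> x _; rewrite mulr_ge0// expR_ge0.
- apply: continuous_subspaceT => x.
  apply: (@differentiable_continuous _ R R); apply/derivable1_diffP.
  apply: ex_derive.
(* [M] bounds the trigonometric factor, so [F] is squeezed to [0] by the exponential. *)
- pose M := `|k| + `|p| + `|q|.
  have h : M * expR (- (a * u)) @[u --> +oo] --> (0 : R).
    by rewrite -[X in _ --> X](mulr0 M); apply: cvgM; [exact: cvg_cst|exact: cvgy_expRN].
  apply/norm_cvg0P.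
  apply: (squeeze_cvgr _ (cvg_cst 0) h).
  near=> u; rewrite normr_ge0 /F normrM mulrC (ger0_norm (expR_ge0 _)) ler_wpM2r ?expR_ge0//.
  rewrite (le_trans (ler_normD _ _))// lerD//.
    rewrite (le_trans (ler_normD _ _))// lerD// normrM ler_piMr//.
    by rewrite ler_norml cos_geN1 cos_le1.
  by rewrite normrM ler_piMr// ler_norml sin_geN1 sin_le1.
- by move=> x _; apply: ex_derive.
- exact/cvg_at_right_filter/cF.
- by move=> x _; rewrite derive1E; apply: derive_val.
Unshelve. all: by end_near.
Qed.

End halfline.

(** * Algebra of the complex exponential *)

Section complex_exponential.
Variable R : realType.
Implicit Types z w : R[i].

Lemma ReM z w : complex.Re (z * w) =
  complex.Re z * complex.Re w - complex.Im z * complex.Im w.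
Proof. by case: z w => [? ?] [? ?]. Qed.

Lemma ImM z w : complex.Im (z * w) =
  complex.Re z * complex.Im w + complex.Im z * complex.Re w.
Proof. by case: z w => [? ?] [? ?]. Qed.

Lemma cexpD z w : cexp (z + w) = cexp z * cexp w.
Proof.
case: z w => [a b] [u v]; apply/eqP.
rewrite /cexp eq_complex /= expRD cosD sinD; apply/andP; split; apply/eqP; ring.
Qed.

Lemma cexp0 : cexp (0 : R[i]) = 1.
Proof. by rewrite /cexp expR0 cos0 sin0 mul1r. Qed.

Lemma cexp_sum (I : finType) (F : I -> R[i]) :
  cexp (\sum_i F i) = \prod_i cexp (F i).
Proof. by apply: (big_morph _ cexpD cexp0). Qed.

End complex_exponential.

(** * Linearity of the complex-valued integral *)

Section complex_integral.
Context {R : realType} {d} {T : measurableType d} (mu : {measure set T -> \bar R}).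
Implicit Types f g : T -> R[i].

Definition Cintegrable f :=
  mu.-integrable setT (EFin \o (fun x => complex.Re (f x))) /\
  mu.-integrable setT (EFin \o (fun x => complex.Im (f x))).

Lemma integrableZl_EFin (k : R) (f : T -> R) :
  mu.-integrable setT (EFin \o f) -> mu.-integrable setT (EFin \o (fun x => k * f x)).
Proof. by move=> /(integrableZl measurableT k). Qed.

Lemma CintegrableZl (c : R[i]) f : Cintegrable f -> Cintegrable (fun x => c * f x).
Proof.
move=> [fr fi]; split.
  apply: eq_integrable (integrableB _ (integrableZl _ (complex.Re c) fr)
    (integrableZl _ (complex.Im c) fi)) => // x _ /=.
  by rewrite ReM EFinB !EFinM.
apply: eq_integrable (integrableD _ (integrableZl _ (complex.Re c) fi)
  (integrableZl _ (complex.Im c) fr)) => // x _ /=.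
by rewrite ImM EFinD !EFinM.
Qed.

Lemma CintegralZl (c : R[i]) f : Cintegrable f ->
  Cintegral mu (fun x => c * f x) = c * Cintegral mu f.
Proof.
move=> [fr fi]; apply/eqP; rewrite eq_complex ReM ImM /=; apply/andP; split; apply/eqP.
  under [LHS]eq_Rintegral do rewrite ReM.
  by rewrite RintegralB ?RintegralZl//; exact: integrableZl_EFin.
under [LHS]eq_Rintegral do rewrite ImM.
by rewrite RintegralD ?RintegralZl//; exact: integrableZl_EFin.
Qed.

Lemma CintegralD f g : Cintegrable f -> Cintegrable g ->
  Cintegral mu (fun x => f x + g x) = Cintegral mu f + Cintegral mu g.
Proof.
move=> [fr fi] [gr gi]; apply/eqP; rewrite eq_complex /=; apply/andP; split; apply/eqP.
  by rewrite -RintegralD//; apply: eq_Rintegral => x _; case: (f x) (g x) => ? ? [].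
by rewrite -RintegralD//; apply: eq_Rintegral => x _; case: (f x) (g x) => ? ? [].
Qed.

Lemma CintegrableD f g : Cintegrable f -> Cintegrable g ->
  Cintegrable (fun x => f x + g x).
Proof.
move=> [fr fi] [gr gi]; split.
  by apply: eq_integrable (integrableD _ fr gr) => // x _ /=; case: (f x) (g x) => ? ? [].
by apply: eq_integrable (integrableD _ fi gi) => // x _ /=; case: (f x) (g x) => ? ? [].
Qed.

Lemma Cintegrable0 : Cintegrable (fun=> 0).
Proof. by split; exact: integrable0. Qed.

Lemma Cintegral_sum (I : eqType) (s : seq I) (f : I -> T -> R[i]) :
  (forall i, i \in s -> Cintegrable (f i)) ->
  Cintegrable (fun x => \sum_(i <- s) f i x) /\
  Cintegral mu (fun x => \sum_(i <- s) f i x) = \sum_(i <- s) Cintegral mu (f i).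
Proof.
elim: s => [|i s IH] fi.
  under eq_fun do rewrite big_nil; rewrite big_nil; split; first exact: Cintegrable0.
  by rewrite /Cintegral /Rintegral /= integral0.
have [IH1 IH2] := IH (fun j js => fi j (@mem_behead _ (i :: s) _ js)).
have {}fi := fi i (mem_head i s).
under eq_fun do rewrite big_cons; rewrite big_cons -IH2.
by split; [exact: CintegrableD|exact: CintegralD].
Qed.

End complex_integral.

(** * Tensor products and image measures *)

Section complex_product.
Context {R : realType} {d1 d2} {T1 : measurableType d1} {T2 : measurableType d2}.
Variables (m1 : {sigma_finite_measure set T1 -> \bar R})
  (m2 : {sigma_finite_measure set T2 -> \bar R}).

(** By Tonelli, the iterated integral of the absolute value factors into two finite integrals. *)
Lemma integrable_tensor (f : T1 -> R) (g : T2 -> R) :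
  m1.-integrable setT (EFin \o f) -> m2.-integrable setT (EFin \o g) ->
  (m1 \x m2)%E.-integrable setT (EFin \o (fun z => f z.1 * g z.2)).
Proof.
move=> fi gi.
have mf : measurable_fun setT f by exact/measurable_EFinP/(measurable_int m1).
have mg : measurable_fun setT g by exact/measurable_EFinP/(measurable_int m2).
apply/integrable12ltyP.
  by apply/measurable_EFinP; apply: measurable_funM;
    [exact: measurableT_comp|exact: measurableT_comp].
have gny : (\int[m2]_y `|g y|%:E)%E \is a fin_num.
  by apply: (integrable_fin_num measurableT); exact: integrable_norm.
under eq_integral => x _.
  under eq_integral do rewrite /= normrM EFinM.
  rewrite integralZl//; last exact: integrable_norm.
  (* The inner integral has to appear as a real constant before it can leave the outer one. *)
  rewrite -(fineK gny).
  over.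
rewrite /= integralZr//; last exact: integrable_norm.
rewrite fineK// lte_mul_pinfty//.
- exact: integral_ge0.
- by apply: (integrable_fin_num measurableT); exact: integrable_norm.
- by rewrite -ge0_fin_numE ?integral_ge0.
Qed.

Lemma Rintegral_tensor (f : T1 -> R) (g : T2 -> R) :
  m1.-integrable setT (EFin \o f) -> m2.-integrable setT (EFin \o g) ->
  \int[(m1 \x m2)%E]_z (f z.1 * g z.2) = \int[m1]_x f x * \int[m2]_y g y.
Proof.
move=> fi gi; rewrite /Rintegral -integral12_prod_meas1; last exact: integrable_tensor.
rewrite /fubini_F /=.
under eq_integral => x _.
  under eq_integral do rewrite EFinM.
  rewrite integralZl//.
  rewrite -[X in (_ * X)%E]fineK; last exact: integrable_fin_num.
  over.
by rewrite /= integralZr// fineM//; exact: integrable_fin_num.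
Qed.

Lemma Cintegral_tensor (f : T1 -> R[i]) (g : T2 -> R[i]) :
  Cintegrable m1 f -> Cintegrable m2 g ->
  Cintegrable (m1 \x m2)%E (fun z => f z.1 * g z.2) /\
  Cintegral (m1 \x m2)%E (fun z => f z.1 * g z.2) =
    Cintegral m1 f * Cintegral m2 g.
Proof.
move=> [fr fi] [gr gi]; split; [split|].
- apply: eq_integrable (integrableB _ (integrable_tensor fr gr)
    (integrable_tensor fi gi)) => // x _ /=.
  by rewrite ReM.
- apply: eq_integrable (integrableD _ (integrable_tensor fr gi)
    (integrable_tensor fi gr)) => // x _ /=.
  by rewrite ImM.
apply/eqP; rewrite eq_complex ReM ImM /=; apply/andP; split; apply/eqP.
  under [LHS]eq_Rintegral do rewrite ReM.
  rewrite RintegralB//; first by rewrite (Rintegral_tensor fr gr) (Rintegral_tensor fi gi).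
    exact: (integrable_tensor fr gr).
  exact: (integrable_tensor fi gi).
under [LHS]eq_Rintegral do rewrite ImM.
rewrite RintegralD//; first by rewrite (Rintegral_tensor fr gi) (Rintegral_tensor fi gr).
  exact: (integrable_tensor fr gi).
exact: (integrable_tensor fi gr).
Qed.

(** Serves both the reflection of the line and the splitting off of the first coordinate of a tuple.
    Measurability of [f] is asked separately because integrability of [f \o phi] only makes the
    composite measurable. *)
Lemma Cintegral_pushforward (phi : T1 -> T2) (mu : {measure set T1 -> \bar R})
    (nu : {measure set T2 -> \bar R}) (f : T2 -> R[i]) :
  measurable_fun setT phi -> (forall B, measurable B -> nu B = pushforward mu phi B) ->
  measurable_fun setT (fun x => complex.Re (f x)) ->
  measurable_fun setT (fun x => complex.Im (f x)) ->
  Cintegrable mu (f \o phi) ->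
  Cintegrable nu f /\ Cintegral nu f = Cintegral mu (f \o phi).
Proof.
move=> mphi nuE mr mi [fr fi].
have key (g : T2 -> R) : measurable_fun setT g ->
    mu.-integrable setT (EFin \o (g \o phi)) ->
    nu.-integrable setT (EFin \o g) /\ \int[nu]_x g x = \int[mu]_x g (phi x).
  move=> mg gi; have mg' : measurable_fun setT (EFin \o g) by exact/measurable_EFinP.
  have E (h : T2 -> \bar R) : (\int[nu]_x h x = \int[pushforward mu phi]_x h x)%E.
    by apply: eq_measure_integral => A mA _; exact: nuE.
  split.
    have /integrableP[_ goo] := integrable_pushforward mphi mg' gi measurableT.
    by apply/integrableP; split=> //; rewrite E.
  by rewrite /Rintegral E (integral_pushforward mphi mg').
have [Ir Er] := key _ mr fr; have [Ii Ei] := key _ mi fi.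
by split; [split|rewrite /Cintegral Er Ei].
Qed.

End complex_product.

(** * Integrals of complex exponentials over half-lines *)

Section halfline_transform.
Variable R : realType.
Local Notation mu := (@lebesgue_measure R).

(** With [D = a ^+ 2 + b ^+ 2], the cosine is obtained for [p = - a / D], [q = b / D]
    and the sine for [p = - b / D], [q = - a / D]. *)
Definition damped (a b p q u : R) : R := expR (- (a * u)) *
  ((- a * p + b * q) * cos (b * u) + (- a * q - b * p) * sin (b * u)).

Lemma measurable_damped a b p q (D : set R) : measurable_fun D (damped a b p q).
Proof.
apply: measurable_funTS; apply: continuous_measurable_fun => x.
apply: (@differentiable_continuous _ R R); apply/derivable1_diffP.
exact: ex_derive.
Qed.

Lemma Rintegral_damped (a b p q : R) : 0 < a ->
  mu.-integrable `[0, +oo[ (EFin \o damped a b p q) /\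
  \int[mu]_(u in `[0, +oo[) damped a b p q u = - p.
Proof.
move=> a0.
pose K := `|- a * p + b * q| + `|- a * q - b * p|.
have K0 : 0 <= K by rewrite addr_ge0.
have trigK u : `|(- a * p + b * q) * cos (b * u) + (- a * q - b * p) * sin (b * u)| <= K.
  rewrite (le_trans (ler_normD _ _))// lerD// normrM ler_piMr// ler_norml.
    by rewrite cos_geN1 cos_le1.
  by rewrite sin_geN1 sin_le1.
(* The shift [k = - (K / a)] adds exactly [K], the bound of the trigonometric part, and so makes the
   shifted integrand nonnegative. *)
have aK : - a * - (K / a) = K by field; rewrite gt_eqF.
pose e u : R := K * expR (- (a * u)).
have me (D : set R) : measurable_fun D e.
  apply: measurable_funTS; apply: continuous_measurable_fun => x.
  apply: (@differentiable_continuous _ R R); apply/derivable1_diffP.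
  exact: ex_derive.
have e0 u : 0 <= e u by rewrite mulr_ge0// expR_ge0.
have Ie : (\int[mu]_(u in `[0%R, +oo[) (e u)%:E = (K / a)%:E)%E.
  (* The exponential alone is the case [k = - (K / a)], [p = q = 0]. *)
  rewrite -[in RHS](opprK (K / a)) -(addr0 (- (K / a))).
  rewrite -(@integral_damped R a b _ 0 0)//; last first.
    by move=> u; rewrite aK !(mulr0, subr0, mul0r, addr0).
  by apply: eq_integral => u _; rewrite aK /e !(mulr0, subr0, mul0r, addr0) mulrC.
have ie : mu.-integrable `[0, +oo[ (EFin \o e).
  apply/integrableP; split; first (apply/measurable_EFinP; apply: me).
  under eq_integral do rewrite /= ger0_norm//.
  by rewrite Ie ltry.
have id : mu.-integrable `[0, +oo[ (EFin \o damped a b p q).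
  apply: le_integrable ie => //.
    by apply/measurable_EFinP; apply: measurable_damped.
  move=> u _ /=; rewrite lee_fin (ger0_norm (e0 _)) /damped normrM /e mulrC.
  by rewrite (ger0_norm (expR_ge0 _)) ler_wpM2r// expR_ge0.
split=> //.
(* The shifted integral is [K / a - p]; cancelling the integral [K / a] of [e] leaves [- p]. *)
apply: (addrI (\int[mu]_(u in `[0, +oo[) e u)); rewrite -RintegralD//.
rewrite {2}/Rintegral Ie /Rintegral.
under eq_integral => u _.
  rewrite (_ : e u + _ = expR (- (a * u)) * (- a * - (K / a) + (- a * p + b * q) * cos (b * u)
      + (- a * q - b * p) * sin (b * u))); last by rewrite aK /e /damped; ring.
  over.
rewrite integral_damped//=; first by rewrite opprD opprK.
by move=> u; rewrite aK -addrA -lerBlDl sub0r; have := trigK u; rewrite ler_norml => /andP[].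
Qed.

(** The origin belongs to the nonnegative side only, so that the product sets of half-lines
    partition the space. *)
Definition halfline (s : bool) (z : R[i]) (u : R) : R[i] :=
  if (if s then 0 <= u else u < 0) then cexp (z * `|u|%:C) else 0.

Lemma Re_inv (z : R[i]) : complex.Re z^-1 =
  complex.Re z / (complex.Re z ^+ 2 + complex.Im z ^+ 2).
Proof. by case: z. Qed.

Lemma Im_inv (z : R[i]) : complex.Im z^-1 =
  - complex.Im z / (complex.Re z ^+ 2 + complex.Im z ^+ 2).
Proof. by case: z => a b /=; rewrite mulNr. Qed.

(** The parameters [p] and [q] are read off the real and imaginary parts of the primitive
    [cexp (z * u) / z]; the two values of [p] are the real and imaginary parts of [z^-1]. *)
Lemma cexp_damped (z : R[i]) (u : R) : complex.Re z < 0 ->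
  let D := complex.Re z ^+ 2 + complex.Im z ^+ 2 in
  cexp (z * u%:C) =
    damped (- complex.Re z) (complex.Im z) (complex.Re z / D) (complex.Im z / D) u
    +i* damped (- complex.Re z) (complex.Im z) (- complex.Im z / D) (complex.Re z / D) u.
Proof.
case: z => a b /= a0; have D0 : a ^+ 2 + b ^+ 2 != 0.
  by rewrite gt_eqF// ltr_pwDl ?sqr_ge0// exprn_even_gt0//= lt_eqF.
rewrite /cexp /damped /= mulr0 subr0 mulr0 add0r mulNr opprK.
apply/eqP; rewrite eq_complex /=; apply/andP; split; apply/eqP; field => //.
Qed.

(** The endpoint is a null set, so the closed ray ([c] true) and the open ray ([c] false) give the
    same integral. *)
Lemma Rintegral_damped_restrict (c : bool) (a b p q : R) : 0 < a ->
  let f := damped a b p q \_ [set` Interval (BSide c 0) +oo%O] in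
  mu.-integrable setT (EFin \o f) /\ \int[mu]_u f u = - p.
Proof.
move=> a0 /=; have [i0 I0] := Rintegral_damped b p q a0.
have sub : [set` Interval (BSide c (0 : R)) +oo%O] `<=` `[0, +oo[.
  by apply: subset_itvr; case: c; rewrite bnd_simp.
have ic : mu.-integrable [set` Interval (BSide c 0) +oo%O] (EFin \o damped a b p q).
  by apply: integrableS i0 => //; exact: measurable_itv.
split.
  by rewrite -restrict_EFin; apply: (iffLR (integrable_mkcond _ _)) ic; exact: measurable_itv.
rewrite -Rintegral_mkcond -I0; case: c sub ic => // _ ic.
by rewrite Rintegral_itv_obnd_cbnd.
Qed.

Let cexp_ray (c : bool) (z : R[i]) (u : R) : R[i] :=
  if (if c then 0 <= u else 0 < u) then cexp (z * u%:C) else 0.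

Let Cintegral_ray (c : bool) (z : R[i]) : complex.Re z < 0 ->
  Cintegrable mu (cexp_ray c z) /\ Cintegral mu (cexp_ray c z) = - z^-1.
Proof.
move=> z0; have a0 : 0 < - complex.Re z by rewrite oppr_gt0.
set D := complex.Re z ^+ 2 + complex.Im z ^+ 2.
have [ir Ir] := Rintegral_damped_restrict c (complex.Im z) (complex.Re z / D)
  (complex.Im z / D) a0.
have [ii Ii] := Rintegral_damped_restrict c (complex.Im z) (- complex.Im z / D)
  (complex.Re z / D) a0.
have memE u : (u \in [set` Interval (BSide c 0) +oo%O]) = (if c then 0 <= u else 0 < u).
  by rewrite mem_setE in_itv /= andbT; case: (c).
have rE : (fun u => complex.Re (cexp_ray c z u)) = damped (- complex.Re z) (complex.Im z)
    (complex.Re z / D) (complex.Im z / D) \_ [set` Interval (BSide c 0) +oo%O].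
  by apply/funext => u; rewrite patchE memE /cexp_ray cexp_damped//; case: (if c then _ else _).
have iE : (fun u => complex.Im (cexp_ray c z u)) = damped (- complex.Re z) (complex.Im z)
    (- complex.Im z / D) (complex.Re z / D) \_ [set` Interval (BSide c 0) +oo%O].
  by apply/funext => u; rewrite patchE memE /cexp_ray cexp_damped//; case: (if c then _ else _).
split; first by split; rewrite ?rE ?iE.
apply/eqP; rewrite /Cintegral rE iE Ir Ii eq_complex /=.
by rewrite !raddfN /= Re_inv Im_inv !eqxx.
Qed.

Lemma Cintegral_halfline (s : bool) (z : R[i]) : complex.Re z < 0 ->
  Cintegrable mu (halfline s z) /\ Cintegral mu (halfline s z) = - z^-1.
Proof.
move=> z0; case: s.
  rewrite (_ : halfline true z = cexp_ray true z); first exact: Cintegral_ray.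
  by apply/funext => u; rewrite /halfline /cexp_ray; case: ifP => // u0; rewrite ger0_norm.
(* The negative half-line is the mirror image of the open positive ray, and Lebesgue measure is
   invariant under reflection. *)
have [i1 I1] := Cintegral_ray false z0.
have E : halfline false z \o -%R = cexp_ray false z.
  apply/funext => u; rewrite /halfline /cexp_ray /= oppr_lt0.
  by case: ifP => // u0; rewrite normrN gtr0_norm.
have E' : halfline false z = cexp_ray false z \o -%R.
  by rewrite -E; apply/funext => u /=; rewrite opprK.
rewrite -I1 -E; apply: Cintegral_pushforward; last by rewrite E.
- exact: oppr_measurable.
- by move=> B mB; rewrite lebesgue_measureN.
- rewrite E'; apply: (measurableT_comp (f := fun u => complex.Re (cexp_ray false z u))).
    by apply/measurable_EFinP; apply: (measurable_int mu); exact: (i1.1).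
  exact: oppr_measurable.
- rewrite E'; apply: (measurableT_comp (f := fun u => complex.Im (cexp_ray false z u))).
    by apply/measurable_EFinP; apply: (measurable_int mu); exact: (i1.2).
  exact: oppr_measurable.
Qed.

End halfline_transform.

(** * Integrals of product functions on [R^d] *)

Section lebesgue_tuple.
Variable R : realType.

Lemma tunconsK n : cancel (@tuncons R n) (@tcons R n).
Proof.
move=> t; apply/val_inj => /=; rewrite [in RHS](tuple_eta t) /=.
by rewrite /thead.
Qed.

Lemma Cintegral_lebd d (h : 'I_d -> R -> R[i]) :
  (forall i, Cintegrable lebesgue_measure (h i)) ->
  Cintegrable (lebd d) (fun t => \prod_i h i (rcoord t i)) /\
  Cintegral (lebd d) (fun t => \prod_i h i (rcoord t i)) =
    \prod_i Cintegral lebesgue_measure (h i).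
Proof.
elim: d h => [|d IHd] h ih.
  under eq_fun do rewrite big_ord0; rewrite big_ord0; split.
    by split; exact: (finite_measure_integrable_cst (dirac _)).
  (* In dimension zero the measure is a Dirac mass, so the empty product integrates to [1]. *)
  have lebd0 : @lebd R 0 setT = 1%E by rewrite /= /dirac indicT.
  rewrite /Cintegral !Rintegral_cst//.
  by rewrite (_ : fine _ = 1) ?mul1r ?mul0r//; exact: (congr1 fine lebd0).
have [IH1 IH2] := IHd (fun i => h (lift ord0 i)) (fun i => ih (lift ord0 i)).
have [i2 I2] := Cintegral_tensor (ih ord0) IH1.
pose f t := \prod_i h i (@rcoord R d.+1 t i).
have E : f \o @tcons R d =
    fun x => h ord0 x.1 * \prod_(i < d) h (lift ord0 i) (rcoord x.2 i).
  apply/funext => x; rewrite /f /= big_ord_recl; congr (_ * _).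
  by apply: eq_bigr => i _; rewrite /rcoord tnthS.
rewrite -E in i2 I2.
(* Measurability of [f] is recovered from that of [f \o tcons] through the measurable inverse
   [tuncons]. *)
have Ef : f = (f \o @tcons R d) \o @tuncons R d.
  by apply/funext => t /=; rewrite tunconsK.
rewrite big_ord_recl -IH2 -I2; apply: Cintegral_pushforward (i2).
- exact: measurable_tcons.
- by [].
- rewrite -/f Ef.
  apply: (measurableT_comp (f := fun u => complex.Re ((f \o @tcons R d) u))).
    by apply/measurable_EFinP; exact: measurable_int i2.1.
  exact: measurable_tuncons.
- rewrite -/f Ef.
  apply: (measurableT_comp (f := fun u => complex.Im ((f \o @tcons R d) u))).
    by apply/measurable_EFinP; exact: measurable_int i2.2.
  exact: measurable_tuncons.
Qed.

End lebesgue_tuple.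

(** * Characteristic roots and finiteness of the eigenvalue tuples *)

Section eigenvalues.
Variable R : realType.

Lemma ceigenvalue_char_poly n (A : 'M[R]_n) (l : R[i]) :
  ceigenvalue A l = root (map_poly (real_complex R) (char_poly A)) l.
Proof. by rewrite /ceigenvalue eigenvalue_root_char map_char_poly. Qed.

Lemma char_poly_companion p (a : {poly R}) :
  a \is monic -> size a = p.+1 -> char_poly (companion p a) = a.
Proof.
(* Once [p] is replaced by [(size a).-1], the cast in [companion] is the identity. *)
move=> ma sa; have {sa}pE : p = (size a).-1 by rewrite sa.
by subst p; rewrite /companion conform_mx_id companionmxK.
Qed.

(** Each characteristic polynomial splits over the complex numbers, so a tuple of eigenvalues is
    determined by a tuple of positions in the lists of roots. Finiteness turns the sum over
    [eigentuples A] into an ordinary finite sum. *)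
Lemma finite_eigentuples d n (A : 'I_d -> 'M[R]_n) : finite_set (eigentuples A).
Proof.
pose f i := map_poly (real_complex R) (char_poly (A i)).
pose rs i : seq R[i] := sval (closed_field_poly_normal (f i)).
have rsP i l : ceigenvalue (A i) l -> l \in rs i.
  rewrite ceigenvalue_char_poly -/(f i) (svalP (closed_field_poly_normal (f i))) -/(rs i).
  by rewrite {1}/f map_char_poly (monicP (char_poly_monic _)) scale1r root_prod_XsubC.
pose N := \max_i size (rs i).
pose g (k : {ffun 'I_d -> 'I_N.+1}) : {ffun 'I_d -> R[i]} :=
  [ffun i => nth 0 (rs i) (k i)].
apply: (@sub_finite_set _ _ (g @` setT)); last exact: finite_image.
move=> l ll; exists [ffun i => inord (index (l i) (rs i))] => //.
apply/ffunP => i; rewrite !ffunE inordK ?nth_index ?rsP//.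
rewrite ltnS (leq_trans (index_size _ _))//.
exact: (leq_bigmax i).
Qed.

End eigenvalues.

(** * Stability and orthant expansion of the autocovariance *)

Section spectral_density.
Context {R : realType} {disp} {T : measurableType disp} (P : probability T R).
Variables (d p : nat) (A : 'I_d -> 'M[R]_p).

(** In the CARMA case the eigenvalues of [A i] are the roots of [a i], its characteristic
    polynomial. From here on both models are treated alike. *)
Lemma causal_stable (b c : 'cV[R]_p) (beta sigma : R)
    (nu : {sigma_finite_measure set (measurableTypeR R) -> \bar R})
    (Lam : set (Rd R d) -> {RV P >-> R}) (Y : Rd R d -> {RV P >-> R}) :
  (exists q : 'I_p, causal_carma q b c A beta sigma nu Lam Y) \/
    causal_gcarma b c A beta sigma nu Lam Y ->
  forall i, stable (A i).
Proof.
case=> [[q [_ [_ [[a aP] _]]]]|[]//] i l.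
have [ma sa re ->] := aP i.
by rewrite ceigenvalue_char_poly char_poly_companion//; exact: re.
Qed.

Lemma prod_halfline (v : {ffun 'I_d -> bool}) (z : 'I_d -> R[i]) (t : Rd R d) :
  \prod_i halfline (v i) (z i) (rcoord t i) =
  if v == [ffun i => 0 <= rcoord t i] then cexp (\sum_i z i * `|rcoord t i|%:C) else 0.
Proof.
case: eqP => [->|vt].
  rewrite cexp_sum; apply: eq_bigr => i _; rewrite /halfline ffunE.
  by case: (leP 0 (rcoord t i)).
have [i vi] : exists i, v i != (0 <= rcoord t i).
  apply/existsP; rewrite -negb_forall; apply/negP => /forallP H; apply: vt.
  by apply/ffunP => i; rewrite ffunE; exact/eqP.
rewrite (bigD1 i)//= /halfline; move: vi.
by case: (v i); case: (leP 0 (rcoord t i)) => // _ _; rewrite mul0r.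
Qed.

Lemma autocov_orthant_expansion (k2 : R) (gamma : Rd R d -> R)
    (coef : {ffun 'I_d -> bool} -> {ffun 'I_d -> R[i]} -> R[i]) (omega t : Rd R d) :
  autocov_representation A k2 gamma coef ->
  (gamma t)%:C * cexp (- ('i * (dotv omega t)%:C)) =
  \sum_(l <- finmap.enum_fset (fset_set (eigentuples A))) \sum_v k2%:C * coef v l *
    \prod_i halfline (v i) (l i - 'i * (sgn v i * rcoord omega i)%:C) (rcoord t i).
Proof.
move=> [_ rep]; pose z (l : {ffun 'I_d -> R[i]}) v i := l i - 'i * (sgn v i * rcoord omega i)%:C.
(* The sign vector of [t], with zero coordinates counted as positive, in agreement with
   [halfline]. *)
pose v0 : {ffun _} := [ffun i => 0 <= rcoord t i] : {ffun 'I_d -> bool}.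
have sgnE i : sgn v0 i * `|rcoord t i| = rcoord t i.
  rewrite /sgn ffunE; case: (leP 0 (rcoord t i)) => [t0|t0].
    by rewrite mul1r ger0_norm.
  by rewrite mulN1r ltr0_norm ?opprK.
rewrite (rep v0); last first.
  move=> i; rewrite /sgn ffunE; case: (leP 0 (rcoord t i)) => t0; first by rewrite mul1r.
  by rewrite mulN1r oppr_ge0 ltW.
rewrite fsbig_finite; last exact: finite_eigentuples.
rewrite big_distrr big_distrl /=; apply: eq_bigr => l _.
rewrite [RHS](bigD1 v0)//= [X in _ = _ + X]big1 ?addr0; last first.
  by move=> v /negPf vv0; rewrite (prod_halfline v (z l v)) -/v0 vv0 mulr0.
rewrite (prod_halfline v0 (z l v0)) -/v0 eqxx mulrA -mulrA -cexpD; congr (_ * _).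
(* The exponents agree because [t_i] is its sign times [|t_i|]. *)
congr cexp; rewrite /dotv rmorph_sum /= mulr_sumr -sumrN -big_split /=.
apply: eq_bigr => i _; rewrite mulrBl; congr (_ - _).
rewrite -mulrA -rmorphM/=; congr (_ * _%:C).
by rewrite mulrAC sgnE mulrC.
Qed.

End spectral_density.

(** * Termwise integration of the expansion *)

Unset Implicit Arguments.

Theorem corollary4p4 (R : realType) (disp : measure_display)
    (T : measurableType disp) (P : probability T R)
    (hP : measure_is_complete P)
    (d p : nat) (b c : 'cV[R]_p) (A : 'I_d -> 'M[R]_p) (beta sigma : R)
    (nu : {sigma_finite_measure set (measurableTypeR R) -> \bar R})
    (Lam : set (Rd R d) -> {RV P >-> R}) (Y : Rd R d -> {RV P >-> R})
    (hY : (exists q : 'I_p, causal_carma q b c A beta sigma nu Lam Y) \/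
          causal_gcarma b c A beta sigma nu Lam Y)
    (hLam : finite_second_moment nu)
    (hA : forall i, distinct_eigenvalues (A i))
    (r : Rd R d)
    (coef : {ffun 'I_d -> bool} -> {ffun 'I_d -> R[i]} -> R[i])
    (hcoef : autocov_representation A (kappa2 sigma nu) (autocov Y r) coef)
    (omega : Rd R d) :
  spectral_density (autocov Y r) omega =
  (kappa2 sigma nu / (2 * pi) ^+ d)%:C *
  \sum_(l \in eigentuples A) \sum_(v : {ffun 'I_d -> bool})
    (coef v l / \prod_(i < d) ('i * (sgn v i * rcoord omega i)%:C - l i)).
Proof.
have stA := causal_stable hY.
have fA := finite_eigentuples A.
pose z (l : {ffun 'I_d -> R[i]}) (v : {ffun 'I_d -> bool}) i :=
  l i - 'i * (sgn v i * rcoord omega i)%:C.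
(* Subtracting a purely imaginary number keeps the real part of the eigenvalue, which is negative by
   stability. *)
have z0 l v i : eigentuples A l -> complex.Re (z l v i) < 0.
  move=> /(_ i) /stA; rewrite /z; case: (l i) => x y /= x0.
  by rewrite mul0r mulr0 !subr0.
have term l v : l \in finmap.enum_fset (fset_set (eigentuples A)) ->
    let f t := (kappa2 sigma nu)%:C * coef v l *
      \prod_i halfline (v i) (z l v i) (rcoord t i) in
    Cintegrable (lebd d) f /\ Cintegral (lebd d) f =
      (kappa2 sigma nu)%:C * coef v l * \prod_i (- (z l v i)^-1).
  rewrite in_fset_set// inE => ll /=.
  have I1 i := Cintegral_halfline (v i) (z0 l v i ll).
  have [I2 I3] := Cintegral_lebd (fun i => (I1 i).1).
  split; first exact: CintegrableZl.
  rewrite CintegralZl// I3; congr (_ * _).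
  by apply: eq_bigr => i _; exact: (I1 i).2.
have sumv l : l \in finmap.enum_fset (fset_set (eigentuples A)) ->
    let f t := \sum_v (kappa2 sigma nu)%:C * coef v l *
      \prod_i halfline (v i) (z l v i) (rcoord t i) in
    Cintegrable (lebd d) f /\ Cintegral (lebd d) f =
      \sum_v (kappa2 sigma nu)%:C * coef v l * \prod_i (- (z l v i)^-1).
  move=> ll /=; have [I1 I2] := Cintegral_sum (fun v _ => (term l v ll).1) (s := index_enum _).
  split; first exact: I1.
  by rewrite I2; apply: eq_bigr => v _; exact: (term l v ll).2.
rewrite /spectral_density.
under [in LHS]eq_fun do rewrite (autocov_orthant_expansion _ _ hcoef).
have [_ ->] := Cintegral_sum (fun l ll => (sumv l ll).1).
rewrite fsbig_finite// rmorphM /= [X in _ = X * _]mulrC -mulrA; congr (_ * _).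
rewrite big_distrr /= big_seq [RHS]big_seq; apply: eq_bigr => l ll.
rewrite (sumv l ll).2 big_distrr /=; apply: eq_bigr => v _.
rewrite -mulrA -prodfV; congr (_ * (_ * _)); apply: eq_bigr => i _.
(* The sign of each one-dimensional integral [- z^-1] is absorbed by reversing the difference in
   [z]. *)
by rewrite -invrN opprB.
Qed.
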